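(* Let $t\ge 1$ and $p\ge 2t+3$ be integers, and let $\mathcal{F}$ be the family of all graphs not containing $K_{p-t}$ as a subgraph. Then, for $n>n_0(p)$ sufficiently large, $$f(n,K_p|\mathcal{F})=g(n,K_p|\langle K_{p-t}\rangle)+1=t(n-t)+\binom{t}{2}+2.$$
   Context: For a graph $F$, $\langle F\rangle$ is the family of all graphs containing $F$ as a subgraph (not necessarily induced). In an edge coloring of $K_n$ (not necessarily proper), for a copy $G'\subseteq K_n$ of a graph $G$, a color class of $G'$ is the graph (without isolated vertices) formed by all edges of $G'$ having a given color that occurs in $G'$. If $K_2\in\mathcal{F}$ and $n\ge|G|$, then $f(n,G|\mathcal{F})$ is the smallest integer $m$ such that in every edge coloring of $K_n$ using at least $m$ colors there exists a copy of $G$ in which all color classes are members of $\mathcal{F}$. If $K_2\notin\mathcal{F}$ and $n\ge|G|$, then $g(n,G|\mathcal{F})$ is the largest integer $m$ for which there exists an edge coloring of $K_n$ using exactly $m$ colors such that every copy of $G$ contains a color class which is a member of $\mathcal{F}$; if no such coloring exists, then $g(n,G|\mathcal{F}):=0$. *)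

(* Defs.v *)
From HB Require Import structures.
From mathcomp Require Import all_boot.
From mathcomp Require Import boolp.

Set Implicit Arguments.
Unset Strict Implicit.
Unset Printing Implicit Defensive.

Record graph := Graph {
  vertex :> finType;
  adj : rel vertex;
  adj_sym : symmetric adj;
  adj_irr : irreflexive adj
}.

Definition graph_family := graph -> Prop.

Definition complete_adj (n : nat) : rel 'I_n := fun x y => x != y.

Lemma complete_adj_sym (n : nat) : symmetric (@complete_adj n).
Proof. by move=> x y; rewrite /complete_adj eq_sym. Qed.

Lemma complete_adj_irr (n : nat) : irreflexive (@complete_adj n).
Proof. by move=> x; rewrite /complete_adj eqxx. Qed.

Definition complete (n : nat) : graph :=
  Graph (@complete_adj_sym n) (@complete_adj_irr n).

(* A copy of [G] in [H] is given by an embedding; it is the subgraph of [H]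
   formed by the images of the vertices and edges of [G], so it need not be
   induced. *)
Record copy (G H : graph) := Copy {
  emb :> G -> H;
  emb_inj : injective emb;
  emb_adj : forall u v : G, adj u v -> adj (emb u) (emb v)
}.

Definition contains (H G : graph) : Prop := inhabited (copy G H).

(* The family written <F> in the literature. *)
Definition supergraphs (F : graph) : graph_family := fun H => contains H F.

Definition edges (n : nat) : {set {set 'I_n}} := [set e : {set 'I_n} | #|e| == 2].

(* The edges of K_n are the 2-subsets of 'I_n; the values of a coloring on the
   other subsets are never looked at. *)
Definition coloring (n : nat) := {set 'I_n} -> nat.

Definition ncolors (n : nat) (c : coloring n) : nat :=
  size (undup [seq c e | e in edges n]).

Lemma ncolors_le (n : nat) (c : coloring n) : ncolors c <= 'C(n, 2).
Proof.
rewrite /ncolors (leq_trans (size_undup _)) // size_map -cardE.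
by rewrite /edges card_draws card_ord.
Qed.

Section ColorClass.

Variables (n : nat) (G : graph) (c : coloring n) (phi : copy G (complete n)).

Definition occurs (k : nat) : Prop :=
  exists u v : G, adj u v /\ c [set phi u; phi v] = k.

Definition class_edge (k : nat) : rel 'I_n := fun x y =>
  [exists u : G, exists v : G, [&& adj u v, phi u == x & phi v == y]]
  && (c [set x; y] == k).

Lemma class_edge_sym (k : nat) : symmetric (class_edge k).
Proof.
move=> x y; rewrite /class_edge setUC; congr (_ && _).
by apply/existsP/existsP => -[u /existsP[v /and3P[uv xu yv]]]; exists v;
  apply/existsP; exists u; rewrite adj_sym uv yv xu.
Qed.

Lemma class_edge_irr (k : nat) : irreflexive (class_edge k).
Proof.
move=> x; apply/negP => /andP[/existsP[u /existsP[v]]].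
case/and3P=> /(emb_adj phi) uv /eqP xu /eqP xv _.
by move: uv; rewrite xu xv adj_irr.
Qed.

Definition class_vertex (k : nat) : finType :=
  {x : 'I_n | [exists y, class_edge k x y]}.

Definition class_adj (k : nat) : rel (class_vertex k) :=
  fun x y => class_edge k (val x) (val y).

Lemma class_adj_sym (k : nat) : symmetric (@class_adj k).
Proof. by move=> x y; apply: class_edge_sym. Qed.

Lemma class_adj_irr (k : nat) : irreflexive (@class_adj k).
Proof. by move=> x; apply: class_edge_irr. Qed.

Definition color_class (k : nat) : graph :=
  Graph (@class_adj_sym k) (@class_adj_irr k).

End ColorClass.

Definition all_classes_in (n : nat) (G : graph) (F : graph_family)
    (c : coloring n) (phi : copy G (complete n)) : Prop :=
  forall k, occurs c phi k -> F (color_class c phi k).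

Definition some_class_in (n : nat) (G : graph) (F : graph_family)
    (c : coloring n) (phi : copy G (complete n)) : Prop :=
  exists2 k, occurs c phi k & F (color_class c phi k).

Definition f_bound (n : nat) (G : graph) (F : graph_family) (m : nat) : Prop :=
  forall c : coloring n, m <= ncolors c ->
  exists phi : copy G (complete n), all_classes_in F c phi.

Lemma f_bound_ex (n : nat) (G : graph) (F : graph_family) :
  exists m, `[< f_bound n G F m >].
Proof.
exists 'C(n, 2).+1; apply/asboolP => c lt_c.
by move: (leq_trans lt_c (ncolors_le c)); rewrite ltnn.
Qed.

(* The two functions are total; they are meaningful when [n >= #|G|] and when
   K_2 belongs to [F] (for [f]), resp. does not belong to [F] (for [g]). *)
Definition f (n : nat) (G : graph) (F : graph_family) : nat :=
  ex_minn (f_bound_ex n G F).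

Definition g_witness (n : nat) (G : graph) (F : graph_family) (m : nat) : Prop :=
  exists2 c : coloring n, ncolors c = m &
  forall phi : copy G (complete n), some_class_in F c phi.

(* No coloring uses more than 'C(n, 2) colors (see [ncolors_le]), and the
   maximum over an empty range is 0. *)
Definition g (n : nat) (G : graph) (F : graph_family) : nat :=
  \max_(m < 'C(n, 2).+1 | `[< g_witness n G F m >]) m.

(* Main.v *)
Require Import Defs.
From mathcomp Require Import all_boot.
From mathcomp Require Import zify.
From mathcomp Require Import boolp.

Set Implicit Arguments.
Unset Strict Implicit.
Unset Printing Implicit Defensive.

(** Write [q = p - t]; the hypothesis on [p] says that [2q >= p + 3]. Call a
    coloring bad if every copy of [K_p] has a color class containing [K_q],
    that is, if every [p]-set of vertices contains a monochromatic [q]-set.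
    Both [f] and [g] are determined by the maximum number of colors of a bad
    coloring ([extremal_number_eq]), and this maximum is
    [t (n - t) + C(t, 2) + 1].

    For the lower bound, fix [t] vertices, give all edges meeting them distinct
    colors and all other edges one further color: a [p]-set keeps at least [q]
    vertices outside the fixed [t].

    For the upper bound, [q]-subsets of two [p]-sets that differ in one vertex
    lie in a set of [p + 1] vertices, hence share at least
    [2q - (p + 1) >= 2] vertices and so an edge. Therefore a single color [k]
    serves all [p]-sets ([mono_color_constant]). The graph of the edges of
    other colors has no matching of size [t + 1]: such a matching lies in some
    [p]-set, where [q] vertices span no edge of it, and the remaining [t]
    vertices cannot meet [t + 1] disjoint edges ([matching_off_color]). By the
    theorem of Erdos and Gallai on matchings, for large [n] such a graph has at
    most [t (n - t) + C(t, 2)] edges ([erdos_gallai_matching]); these carry at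
    most that many colors, and [k] is one more. *)

(** * Finite sets *)

Lemma subset_of_card (T : finType) (A : {set T}) (k : nat) :
  k <= #|A| -> exists2 B : {set T}, B \subset A & #|B| = k.
Proof.
move=> /card_geqP[s [s_uniq <- sA]]; exists [set x in s].
  by apply/subsetP => x; rewrite inE => /sA.
by rewrite cardsE (card_uniqP s_uniq).
Qed.

Lemma superset_of_card (T : finType) (A : {set T}) (k : nat) :
  #|A| <= k <= #|T| -> exists2 B : {set T}, A \subset B & #|B| = k.
Proof.
move=> /andP[leAk lekT].
have [|B BA cardB] := @subset_of_card T (~: A) (k - #|A|).
  by have := cardsC A; lia.
exists (A :|: B); first exact: subsetUl.
rewrite cardsU setIC (_ : B :&: A = set0) ?cards0; first lia.
by apply/eqP; rewrite setI_eq0 disjoints_subset.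
Qed.

Lemma sub_trivIset (T : finType) (M N : {set {set T}}) :
  M \subset N -> trivIset N -> trivIset M.
Proof.
by move=> /subsetP sub /trivIsetP triv; apply/trivIsetP => A B /sub NA /sub;
  apply: triv.
Qed.

Lemma card_matching_cover (T : finType) (M : {set {set T}}) :
  {in M, forall e : {set T}, #|e| = 2} -> trivIset M -> #|cover M| = 2 * #|M|.
Proof.
move=> two /eqP <-; rewrite (eq_bigr (fun=> 2)) ?sum_nat_const; first lia.
by move=> e /two.
Qed.

(** Such an edge is determined by its other end, which lies in [C]. *)
Lemma card_star_meeting (T : finType) (E : {set {set T}}) (v : T)
    (C : {set T}) :
  {in E, forall e : {set T}, #|e| = 2} -> v \notin C ->
  #|[set e in E | (v \in e) && ~~ [disjoint e & C]]| <= #|C|.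
Proof.
move=> two vC; apply: leq_trans (leq_imset_card (fun w => [set v; w]) C).
apply/subset_leq_card/subsetP => e; rewrite !inE => /and3P[eE ve].
move=> /pred0Pn[w /andP[/= we wC]]; apply/imsetP; exists w => //.
have neq_vw : v != w by apply: contraNneq vC => ->.
apply/esym/eqP; rewrite eqEcard (two _ eE) cards2 neq_vw andbT.
by apply/subsetP => x; rewrite !inE => /orP[] /eqP ->.
Qed.

Lemma card_star (T : finType) (V : {set T}) (E : {set {set T}}) (v : T) :
  {in E, forall e : {set T}, #|e| = 2 /\ e \subset V} -> v \in V ->
  #|[set e in E | v \in e]| <= #|V|.-1.
Proof.
move=> edgeE vV; have := cardsD1 v V; rewrite vV => -> /=.
have two : {in E, forall e : {set T}, #|e| = 2} by move=> e /edgeE[].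
apply: leq_trans (card_star_meeting two (_ : v \notin V :\ v)); last first.
  by rewrite !inE eqxx.
apply/subset_leq_card/subsetP => e; rewrite !inE => /andP[eE ve].
rewrite eE ve /=; have [e2 /subsetP eV] := edgeE _ eE.
have /card_gt0P[w] : 0 < #|e :\ v| by have := cardsD1 v e; rewrite ve; lia.
rewrite !inE => /andP[wv we]; apply/pred0Pn; exists w.
by rewrite /= !inE we wv eV.
Qed.

(** * Graphs without large matchings *)

(** A vertex on more than [2t] edges extends every matching avoiding it: the
    [2t] vertices of a matching of size [t] cannot meet all edges of its
    star. *)
Lemma matching_del_vertex (T : finType) (E : {set {set T}}) (t : nat) (v : T) :
  {in E, forall e : {set T}, #|e| = 2} ->
  (forall M : {set {set T}}, M \subset E -> trivIset M -> #|M| <= t.+1) ->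
  2 * t.+1 < #|[set e in E | v \in e]| ->
  forall M : {set {set T}}, M \subset [set e in E | v \notin e] ->
    trivIset M -> #|M| <= t.
Proof.
move=> two match_le deg M subM trivM; rewrite leqNgt; apply/negP => ltM.
have vM e : e \in M -> (e \in E) && (v \notin e).
  by move=> /(subsetP subM); rewrite inE.
have ME : M \subset E by apply/subsetP => e /vM /andP[].
have cM : #|cover M| = 2 * #|M|.
  by apply: card_matching_cover => // e /(subsetP ME) /two.
have v_cover : v \notin cover M.
  by apply/bigcupP => -[e /vM /andP[_ /negP]].
have Mt := match_le M ME trivM.
have [e eE /andP[ve dis]] : exists2 e, e \in E &
    (v \in e) && [disjoint e & cover M].
  have := card_star_meeting two v_cover.
  case: (boolP [exists e in E, (v \in e) && [disjoint e & cover M]]).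
    by move=> /exists_inP.
  rewrite negb_exists_in => /forall_inP none le_star; exfalso.
  suff: #|[set e in E | v \in e]| <= #|cover M| by lia.
  apply: leq_trans le_star; apply/subset_leq_card/subsetP => e.
  rewrite !inE => /andP[eE ve]; rewrite eE ve /=.
  by have := none e eE; rewrite ve.
have [||trivM' eM] := @trivIsetU1 _ e M _ trivM.
- by move=> B BM; apply: disjointWr dis; apply: bigcup_sup.
- by apply/negP => /(subsetP ME) /two; rewrite cards0.
have := match_le (e |: M) _ trivM'; rewrite cardsU1 eM subUset sub1set eE ME.
by move=> /(_ isT); lia.
Qed.

(** If all degrees are at most [d], the at most [2t] vertices of a maximum
    matching meet every edge. *)
Lemma card_edges_low_degree (T : finType) (E : {set {set T}}) (t d : nat) :
  {in E, forall e : {set T}, #|e| = 2} ->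
  (forall M : {set {set T}}, M \subset E -> trivIset M -> #|M| <= t) ->
  (forall v, #|[set e in E | v \in e]| <= d) ->
  #|E| <= 2 * t * d.
Proof.
move=> two match_le deg.
pose P := [pred M : {set {set T}} | (M \subset E) && trivIset M].
have P0 : P set0.
  by rewrite /= sub0set; apply/trivIsetP => A B; rewrite inE.
case: (arg_maxnP (fun M : {set {set T}} => #|M|) P0) => M /andP[ME trivM] maxM.
have cM : #|cover M| = 2 * #|M|.
  by apply: card_matching_cover => // e /(subsetP ME) /two.
have Mt := match_le M ME trivM.
have coverE : E \subset \bigcup_(v in cover M) [set e in E | v \in e].
  apply/subsetP => e eE; apply/bigcupP.
  have : ~~ [disjoint e & cover M].
    apply/negP => dis; have [||trivM' eM] := @trivIsetU1 _ e M _ trivM.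
    - by move=> B BM; apply: disjointWr dis; apply: bigcup_sup.
    - by apply/negP => /(subsetP ME) /two; rewrite cards0.
    have /maxM : P (e |: M) by rewrite /= subUset sub1set eE ME.
    by rewrite cardsU1 eM; lia.
  by move=> /pred0Pn[v /andP[/= ve vM]]; exists v => //; rewrite inE eE.
apply: leq_trans (subset_leq_card coverE) _.
apply: leq_trans (_ : \sum_(v in cover M) #|[set e in E | v \in e]| <= _).
  elim/big_rec2: _ => [|v m A _ IH]; first by rewrite cards0.
  by rewrite cardsU; lia.
apply: (@leq_trans (\sum_(v in cover M) d)); first exact: leq_sum.
by rewrite sum_nat_const cM leq_mul2r leq_mul2l Mt !orbT.
Qed.

(** The Erdos-Gallai bound for matchings, on a large vertex set. A vertex of
    degree above [2t] is deleted, which lowers the matching number; once there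
    is none, the number of edges is bounded in terms of [t] alone. *)
Lemma erdos_gallai_matching (T : finType) (t : nat) (V : {set T})
    (E : {set {set T}}) :
  {in E, forall e : {set T}, #|e| = 2 /\ e \subset V} ->
  (forall M : {set {set T}}, M \subset E -> trivIset M -> #|M| <= t) ->
  5 * t <= #|V| -> #|E| <= t * (#|V| - t) + 'C(t, 2).
Proof.
elim: t V E => [|t IH] V E edgeE match_le largeV.
  rewrite mul0n bin0n leqn0 cards_eq0; apply: contraT => /set0Pn[e eE].
  have := match_le [set e]; rewrite sub1set cards1; apply=> //.
  by apply/trivIsetP => A B /set1P-> /set1P->; rewrite eqxx.
have two : {in E, forall e : {set T}, #|e| = 2} by move=> e /edgeE[].
case: (boolP [exists v, 2 * t.+1 < #|[set e in E | v \in e]|]); last first.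
  rewrite negb_exists => /forallP low.
  have /(card_edges_low_degree two match_le) :
    forall v, #|[set e in E | v \in e]| <= 2 * t.+1.
    by move=> v; rewrite leqNgt.
  (* [#|E|] is at most [2 s * 2 s] with [s = t + 1], and [n - s >= 4 s]. *)
  have : t.+1 * (4 * t.+1) <= t.+1 * (#|V| - t.+1) by rewrite leq_mul2l; lia.
  lia.
move=> /existsP[v deg].
have vV : v \in V.
  have /card_gt0P[e] : 0 < #|[set e in E | v \in e]| by lia.
  by rewrite inE => /andP[/edgeE[_ /subsetP eV]] /eV.
have cV := cardsD1 v V; rewrite vV in cV.
have leE' : #|[set e in E | v \notin e]| <= t * (#|V :\ v| - t) + 'C(t, 2).
  apply: IH; last lia.
    move=> e; rewrite inE => /andP[/edgeE[e2 eV] ve]; split=> //.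
    by rewrite subsetD1 eV.
  exact: matching_del_vertex two match_le deg.
have le_star := card_star edgeE vV.
have -> : #|E| = #|[set e in E | v \in e]| + #|[set e in E | v \notin e]|.
  rewrite -(cardsID [set e : {set T} | v \in e] E).
  by congr (_ + _); apply: eq_card => e; rewrite !inE // andbC.
rewrite binS bin1; have -> : #|V| - t.+1 = #|V :\ v| - t by lia.
move: le_star leE'; rewrite cV /=; set m := #|_ :\ _| in cV *.
have -> : t.+1 * (m - t) = t * (m - t) + (m - t) by rewrite mulSn addnC.
lia.
Qed.

(** * Monochromatic cliques *)

Definition mono (n : nat) (c : coloring n) (k : nat) (Q : {set 'I_n}) :=
  {in Q &, forall x y, x != y -> c [set x; y] = k}.

(** A single vertex is a clique but spans no edge, hence lies in no color class
    by itself: this is where [1 < q] enters. *)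
Lemma some_class_cliqueP (n p q : nat) (c : coloring n)
    (phi : copy (complete p) (complete n)) : 1 < q ->
  some_class_in (supergraphs (complete q)) c phi <->
  exists k, exists Q : {set 'I_n},
    [/\ Q \subset phi @: [set: 'I_p], #|Q| = q & mono c k Q].
Proof.
move=> q_gt1; split.
  move=> [k _ [psi]]; exists k; exists [set val (psi i) | i in [set: 'I_q]].
  split.
  - apply/subsetP => _ /imsetP[i _ ->].
    have /existsP[y /andP[/existsP[u /existsP[v /and3P[_ /eqP <- _]]] _]] :=
      valP (psi i).
    exact: imset_f.
  - rewrite card_imset ?cardsT ?card_ord // => i j /val_inj.
    exact: (@emb_inj _ _ psi).
  - move=> _ _ /imsetP[i _ ->] /imsetP[j _ ->] neq.
    have ij : @adj (complete q) i j by apply: contraNneq neq => ->.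
    by have /andP[_ /eqP] := emb_adj psi ij.
move=> [k [Q [Qphi cardQ monoQ]]].
have edgeQ x y : x \in Q -> y \in Q -> x != y -> class_edge c phi k x y.
  move=> xQ yQ xy; apply/andP; split; last by rewrite monoQ.
  have /imsetP[u _ xu] := subsetP Qphi x xQ.
  have /imsetP[v _ yv] := subsetP Qphi y yQ.
  apply/existsP; exists u; apply/existsP; exists v; rewrite xu yv !eqxx !andbT.
  by apply: contraNneq xy => uv; rewrite xu yv uv.
have Q_other x : exists y, (y \in Q) && (x != y).
  have /card_gt0P[y] : 0 < #|Q :\ x| by have := cardsD1 x Q; case: (x \in Q); lia.
  by rewrite !inE eq_sym => /andP[xy yQ]; exists y; rewrite yQ.
exists k.
  have /card_gt0P[x xQ] : 0 < #|Q| by lia.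
  have [y /andP[yQ xy]] := Q_other x.
  have /andP[/existsP[u /existsP[v /and3P[uv /eqP xu /eqP yv]]] /eqP ck] :=
    edgeQ x y xQ yQ xy.
  by exists u; exists v; rewrite xu yv.
pose h (i : 'I_q) : 'I_n := enum_val (cast_ord (esym cardQ) i).
have hQ i : h i \in Q by apply: enum_valP.
have h_inj : injective h by move=> i j /enum_val_inj /cast_ord_inj.
have h_class i : [exists y, class_edge c phi k (h i) y].
  have [y /andP[yQ xy]] := Q_other (h i).
  by apply/existsP; exists y; apply: edgeQ.
pose psi i : class_vertex c phi k := Sub (h i) (h_class i).
have psi_inj : injective psi by move=> i j /(congr1 val) /h_inj.
constructor; apply: (@Copy (complete q) (color_class c phi k) psi psi_inj).
by move=> i j ij; apply: (edgeQ (h i) (h j)); rewrite ?hQ ?(inj_eq h_inj).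
Qed.

(** Copies of [K_p] in [K_n] are the [p]-subsets of the vertex set. *)
Lemma every_copy_cliqueP (n p q : nat) (c : coloring n) : 1 < q ->
  (forall phi : copy (complete p) (complete n),
     some_class_in (supergraphs (complete q)) c phi) <->
  (forall S : {set 'I_n}, #|S| = p -> exists k, exists Q : {set 'I_n},
     [/\ Q \subset S, #|Q| = q & mono c k Q]).
Proof.
move=> q_gt1; split=> [bad S cardS | bad phi]; last first.
  apply/(some_class_cliqueP c phi q_gt1); apply: bad.
  by rewrite card_imset ?cardsT ?card_ord //; exact: (@emb_inj _ _ phi).
pose h (i : 'I_p) : 'I_n := enum_val (cast_ord (esym cardS) i).
have h_inj : injective h by move=> i j /enum_val_inj /cast_ord_inj.
have h_adj (u v : complete p) : adj u v -> @adj (complete n) (h u) (h v).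
  by rewrite /= /complete_adj (inj_eq h_inj).
pose phi : copy (complete p) (complete n) :=
  @Copy (complete p) (complete n) h h_inj h_adj.
have /(some_class_cliqueP c phi q_gt1)[k [Q [QS cardQ monoQ]]] := bad phi.
exists k, Q; split=> //; apply: subset_trans QS _.
by apply/subsetP => _ /imsetP[i _ ->]; apply: enum_valP.
Qed.

(** Two [q]-subsets of a set of [p + 1] vertices share an edge, so moving from
    one [p]-set to another by exchanging one vertex at a time never changes
    the color of the monochromatic [q]-clique. *)
Lemma mono_color_constant (n p q : nat) (c : coloring n) : p + 3 <= 2 * q ->
  (forall S : {set 'I_n}, #|S| = p -> exists k, exists Q : {set 'I_n},
     [/\ Q \subset S, #|Q| = q & mono c k Q]) ->
  exists k, forall S : {set 'I_n}, #|S| = p -> exists Q : {set 'I_n},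
     [/\ Q \subset S, #|Q| = q & mono c k Q].
Proof.
move=> large_q cliques.
case: (boolP [exists S : {set 'I_n}, #|S| == p]); last first.
  rewrite negb_exists => /forallP none; exists 0 => S /eqP cardS.
  by have := none S; rewrite cardS.
move=> /existsP[S0 /eqP cardS0].
have [k [Q0 [Q0S cardQ0 monoQ0]]] := cliques S0 cardS0.
exists k => S; have [d] := ubnP #|S :\: S0|.
elim: d S => // d IH S le_d cardS.
have [SS0|/subsetPn[y yS yS0]] := boolP (S \subset S0).
  have -> : S = S0 by apply/eqP; rewrite eqEcard SS0 cardS cardS0 /=.
  by exists Q0.
have cSI := cardsID S0 S; have cS0I := cardsID S S0.
have dpos : 0 < #|S :\: S0| by apply/card_gt0P; exists y; rewrite inE yS0.
have /card_gt0P[x] : 0 < #|S0 :\: S| by rewrite setIC in cS0I; lia.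
rewrite inE => /andP[xS xS0].
(* [S'] is one exchange closer to [S0] than [S] is. *)
pose S' := x |: (S :\ y).
have cardS' : #|S'| = p.
  rewrite /S' cardsU1 !inE (negPf xS) andbF.
  by have := cardsD1 y S; rewrite yS; lia.
have [|Q' [Q'S cardQ' monoQ']] := IH S' _ cardS'.
  apply: leq_trans (_ : #|S :\: S0| <= d); last lia.
  apply: proper_card; apply/properP; split.
    apply/subsetP => z; rewrite !inE => /andP[zS0 /orP[/eqP zx|/andP[_ ->]]].
      by rewrite zx xS0 in zS0.
    by rewrite zS0.
  by exists y; rewrite !inE ?yS0 ?yS // eqxx /= orbF; apply: contraNneq yS0 => ->.
have [k' [Q [QS cardQ monoQ]]] := cliques S cardS.
have QU : Q :|: Q' \subset x |: S.
  rewrite subUset (subset_trans QS (subsetUr _ _)).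
  by rewrite (subset_trans Q'S) // setUS // subsetDl.
have := subset_leq_card QU; rewrite cardsU1 xS cardS => leU.
have /card_gt1P[a [b [/setIP[aQ aQ'] /setIP[bQ bQ'] ab]]] : 1 < #|Q :&: Q'|.
  by have := cardsUI Q Q'; lia.
by exists Q; rewrite -(monoQ' a b aQ' bQ' ab) (monoQ a b aQ bQ ab).
Qed.

(** * The upper bound *)

(** An edge inside a [p]-set [S] that is not of color [k] has at most one vertex
    in the [k]-colored [q]-clique of [S], so the edges of a matching inside [S]
    use distinct vertices among the other [t]. *)
Lemma matching_off_color (n p q t : nat) (c : coloring n) (k : nat) :
  p <= n -> q + t = p -> 2 * t.+1 <= p ->
  (forall S : {set 'I_n}, #|S| = p -> exists Q : {set 'I_n},
     [/\ Q \subset S, #|Q| = q & mono c k Q]) ->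
  forall M : {set {set 'I_n}}, M \subset [set e in edges n | c e != k] ->
    trivIset M -> #|M| <= t.
Proof.
move=> le_pn qt le_tp cliques M0 subM0 trivM0; rewrite leqNgt; apply/negP.
move=> /subset_of_card[M MM0 cardM].
have trivM := sub_trivIset MM0 trivM0; have subM := subset_trans MM0 subM0.
have two : {in M, forall e : {set 'I_n}, #|e| = 2}.
  by move=> e /(subsetP subM); rewrite !inE => /andP[/eqP].
have cM := card_matching_cover two trivM; rewrite cardM in cM.
have [|S MS cardS] := @superset_of_card _ (cover M) p.
  by rewrite cM card_ord le_tp.
have [Q [QS cardQ monoQ]] := cliques S cardS.
have one e : e \in M -> #|e :&: Q| <= 1.
  move=> eM; rewrite leqNgt; apply/negP.
  move=> /card_gt1P[a [b [/setIP[ae aQ] /setIP[be bQ] ab]]].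
  have := subsetP subM e eM; rewrite inE => /andP[_ /negP]; apply; apply/eqP.
  rewrite -(monoQ a b aQ bQ ab); congr c; apply/esym/eqP.
  rewrite eqEcard (two e eM) cards2 ab andbT.
  by apply/subsetP => x; rewrite !inE => /orP[] /eqP ->.
have leI : #|cover M :&: Q| <= t.+1.
  have -> : #|cover M :&: Q| = \sum_(x in cover M | x \in Q) 1.
    by rewrite sum1dep_card; apply: eq_card => x; rewrite !inE.
  rewrite big_trivIset_cond // -cardM -sum1_card; apply: leq_sum => e eM.
  rewrite sum1dep_card; apply: leq_trans (one e eM).
  by apply/eq_leq/eq_card => x; rewrite !inE.
have : #|cover M :|: Q| <= p by rewrite -cardS subset_leq_card // subUset MS.
by rewrite cardsU; lia.
Qed.

Lemma ncolors_le_off_color (n : nat) (c : coloring n) (k : nat) :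
  ncolors c <= #|[set e in edges n | c e != k]| + 1.
Proof.
rewrite addn1 cardE -(size_map c).
apply: (@uniq_leq_size _ _ (k :: [seq c e | e <- _])); first exact: undup_uniq.
move=> j; rewrite mem_undup inE => /mapP[e]; rewrite mem_enum => eE ->.
have [//|neq] := eqVneq (c e) k; apply: map_f.
by rewrite mem_enum inE eE.
Qed.

Lemma ncolors_bad_le (n p t : nat) (c : coloring n) :
  2 * t + 3 <= p -> 5 * p <= n ->
  (forall phi : copy (complete p) (complete n),
     some_class_in (supergraphs (complete (p - t))) c phi) ->
  ncolors c <= t * (n - t) + 'C(t, 2) + 1.
Proof.
move=> le_tp le_pn /every_copy_cliqueP-/(_ ltac:(lia)).
move=> /mono_color_constant-/(_ ltac:(lia))[k cliques].
apply: leq_trans (ncolors_le_off_color c k) _; rewrite leq_add2r.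
have := @erdos_gallai_matching _ t [set: 'I_n] [set e in edges n | c e != k].
rewrite cardsT card_ord; apply; last lia.
  by move=> e; rewrite !inE => /andP[/eqP -> _]; rewrite subsetT.
by apply: matching_off_color cliques; lia.
Qed.

(** * The extremal coloring *)

Definition rainbow_coloring (n : nat) (T : {set 'I_n}) : coloring n :=
  fun e => if [disjoint e & T] then 0 else (enum_rank e).+1.

Lemma rainbow_coloring_cliques (n p t : nat) (T : {set 'I_n}) :
  #|T| = t -> forall S : {set 'I_n}, #|S| = p ->
  exists k, exists Q : {set 'I_n},
    [/\ Q \subset S, #|Q| = p - t & mono (rainbow_coloring T) k Q].
Proof.
move=> cardT S cardS.
have [|Q QST cardQ] := @subset_of_card _ (S :\: T) (p - t).
  by have := cardsID T S; have := subset_leq_card (subsetIr S T); lia.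
move: QST; rewrite subsetD => /andP[QS QT].
exists 0, Q; split=> // x y xQ yQ _; rewrite /rainbow_coloring.
by rewrite (disjointWl _ QT) // subUset !sub1set xQ.
Qed.

Lemma binD2 (m k : nat) : 'C(m + k, 2) = 'C(m, 2) + k * m + 'C(k, 2).
Proof.
elim: k => [|k IH]; first by rewrite addn0 mul0n bin0n !addn0.
by rewrite addnS !binS !bin1 IH mulSn; lia.
Qed.

Lemma card_edges_meeting (n : nat) (T : {set 'I_n}) :
  #|[set e in edges n | ~~ [disjoint e & T]]| =
    #|T| * (n - #|T|) + 'C(#|T|, 2).
Proof.
have cT := cardsC T; rewrite card_ord in cT.
have cE : #|edges n| = 'C(n, 2) by rewrite /edges card_draws card_ord.
have := cardsID [set e : {set 'I_n} | [disjoint e & T]] (edges n).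
have -> : #|edges n :&: [set e : {set 'I_n} | [disjoint e & T]]| =
    'C(#|~: T|, 2).
  rewrite -cards_draws; apply: eq_card => e.
  by rewrite !inE disjoints_subset andbC.
have -> : edges n :\: [set e : {set 'I_n} | [disjoint e & T]] =
    [set e in edges n | ~~ [disjoint e & T]].
  by apply/setP => e; rewrite !inE andbC.
have -> : #|edges n| = 'C(#|~: T| + #|T|, 2) by rewrite cE addnC cT.
rewrite binD2.
have -> : n - #|T| = #|~: T| by lia.
by rewrite -addnA => /addnI.
Qed.

Lemma ncolors_rainbow (n : nat) (T : {set 'I_n}) : #|T| + 2 <= n ->
  ncolors (rainbow_coloring T) = #|T| * (n - #|T|) + 'C(#|T|, 2) + 1.
Proof.
move=> le_Tn; rewrite -card_edges_meeting addn1 cardE.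
set ET := [set e in edges n | _].
rewrite -(size_map (fun e : {set 'I_n} => (enum_rank e).+1)).
pose s := 0 :: [seq (enum_rank e).+1 | e : {set 'I_n} <- enum ET].
rewrite -[RHS]/(size s); apply/perm_size/uniq_perm; first exact: undup_uniq.
  rewrite /= map_inj_uniq ?enum_uniq ?andbT; last first.
    by move=> e e' [] /ord_inj /enum_rank_inj.
  by apply/negP => /mapP[].
move=> j; rewrite mem_undup inE; apply/mapP/orP.
  move=> [e]; rewrite mem_enum => eE ->; rewrite /rainbow_coloring.
  case: ifP => dis; first by left.
  by right; apply/mapP; exists e; rewrite // mem_enum inE eE dis.
move=> [/eqP ->|/mapP[e]].
  have [|e eT e2] := @subset_of_card _ (~: T) 2.
    by have := cardsC T; rewrite card_ord; lia.
  exists e; first by rewrite mem_enum inE e2.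
  by rewrite /rainbow_coloring disjoints_subset eT.
rewrite mem_enum inE => /andP[eE /negPf dis] ->.
by exists e; rewrite ?mem_enum // /rainbow_coloring dis.
Qed.

(** * The two extremal functions *)

(** The colorings excluded by the definition of [f] are those admitted by the
    definition of [g], so both functions are determined by the largest number
    of colors in such a coloring. *)
Lemma extremal_number_eq (n : nat) (G : graph) (F : graph_family) (N : nat) :
  g_witness n G F N -> (forall m, g_witness n G F m -> m <= N) ->
  g n G F = N /\ f n G (fun H => ~ F H) = N + 1.
Proof.
move=> wN maxN; split.
  have ltN : N < 'C(n, 2).+1 by have [c <- _] := wN; rewrite ltnS ncolors_le.
  apply/eqP; rewrite eqn_leq; apply/andP; split.
    by apply/bigmax_leqP => m /asboolP; apply: maxN.
  by rewrite /g (bigD1 (Ordinal ltN)) /= ?leq_maxl //; apply/asboolP.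
rewrite /f; case: ex_minnP => m /asboolP bound_m min_m.
apply/eqP; rewrite eqn_leq; apply/andP; split.
  apply: min_m; apply/asboolP => c le_c; apply: contrapT => no_copy.
  suff /maxN : g_witness n G F (ncolors c) by lia.
  exists c => // phi; apply: contrapT => no_class; apply: no_copy.
  by exists phi => k occ Fk; apply: no_class; exists k.
rewrite leqNgt; apply/negP => lt_mN; have [c cN bad] := wN.
have [|phi good] := bound_m c; first by lia.
by have [k /good] := bad phi.
Qed.

Theorem theorem9p30 (p : nat) :
  exists n0 : nat, forall t n : nat,
    1 <= t -> 2 * t + 3 <= p -> n0 < n ->
    f n (complete p) (fun H => ~ contains H (complete (p - t)))
      = g n (complete p) (supergraphs (complete (p - t))) + 1 /\
    g n (complete p) (supergraphs (complete (p - t))) + 1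
      = t * (n - t) + 'C(t, 2) + 2.
Proof.
(* [n > 5 p] ensures both [5 t <= n], for the bound on matchings, and
   [p <= n]. *)
exists (5 * p) => t n t_gt0 le_tp lt_pn.
have [||gN fN] := @extremal_number_eq n (complete p)
  (supergraphs (complete (p - t))) (t * (n - t) + 'C(t, 2) + 1).
- have [|T _ cardT] := @subset_of_card _ [set: 'I_n] t.
    by rewrite cardsT card_ord; lia.
  exists (rainbow_coloring T).
    by rewrite ncolors_rainbow cardT //; lia.
  apply/every_copy_cliqueP; first lia.
  exact: rainbow_coloring_cliques.
- by move=> m [c <- bad]; apply: (ncolors_bad_le le_tp) bad; lia.
by rewrite gN; split; [exact: fN | lia].
Qed.
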